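(* Let $p$ be an odd prime. For every integer $m\geq 3$, there exists a string C-group $(G,\{\rho_0,\rho_1,\rho_2\})$ of rank three, of order $4p^m$ and Schläfli type $\{p,2p\}$, such that the Sylow $p$-subgroups of $G$ are nonabelian.
   Context: A string C-group of rank three is a pair $(G,\{\rho_0,\rho_1,\rho_2\})$ where $G$ is a group and $(\rho_0,\rho_1,\rho_2)$ is an ordered triple of distinct involutions of $G$ such that: $G=\langle\rho_0,\rho_1,\rho_2\rangle$; $\rho_0\rho_2=\rho_2\rho_0$ (string property); and for all $I,J\subseteq\{0,1,2\}$, $\langle\rho_i\mid i\in I\rangle\cap\langle\rho_j\mid j\in J\rangle=\langle\rho_k\mid k\in I\cap J\rangle$ (intersection property). Its order is $|G|$. Its Schläfli type is the ordered pair $\{o(\rho_0\rho_1),o(\rho_1\rho_2)\}$, where $o(g)$ is the order of $g$. *)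

(* Defs.v *)
From mathcomp Require Import all_boot all_fingroup all_solvable.

Set Implicit Arguments.
Unset Strict Implicit.
Unset Printing Implicit Defensive.

Local Open Scope group_scope.

Definition i0 : 'I_3 := @Ordinal 3 0 isT.
Definition i1 : 'I_3 := @Ordinal 3 1 isT.
Definition i2 : 'I_3 := @Ordinal 3 2 isT.

Definition intersection_property (gT : finGroupType) (rho : 'I_3 -> gT) : Prop :=
  forall I J : {set 'I_3},
    <<rho @: I>> :&: <<rho @: J>> = <<rho @: (I :&: J)>>.

(* An involution is an element of order exactly 2, so the identity is excluded.
   The group is a subgroup G of an ambient finite group; all groups of
   prescribed order are finite, so finiteness loses no generality there. *)
Definition string_C_group3 (gT : finGroupType) (G : {group gT})
    (rho : 'I_3 -> gT) : Prop :=
  [/\ injective rho /\ (forall i, #[rho i] = 2),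
      G :=: <<rho @: [set: 'I_3]>>,
      commute (rho i0) (rho i2)
    & intersection_property rho].

Definition schlafli_type (gT : finGroupType) (rho : 'I_3 -> gT) : nat * nat :=
  (#[rho i0 * rho i1], #[rho i1 * rho i2]).

(* Main.v *)
Require Import Defs.
From mathcomp Require Import all_boot all_fingroup all_solvable.
From mathcomp Require Import ssralg zmodp zify.

(** Let G be generated by r0, r1, r2 subject to at least the relations of the
    Coxeter group [p, 2p], and put x = r0 r1, y = x^r2.  The subgroup P generated
    by x and y is the image of the kernel of the homomorphism of [p, 2p] onto
    C2 x C2 that identifies r0 with r1.  It is normal, since r0 inverts x and y
    and r2 exchanges them, and G = P <r0, r2>.

    Three facts give the result.

    First, the numerical data decide everything: if the relations hold, if
    |P| = p^m with m >= 3 and if |G| = 4 p^m, then G is a string C-group of type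
    {p, 2p} (recognition).  Each pair of generators spans a dihedral group with
    at most 4p elements, too small to contain the third generator, and a
    subgroup of order 2 is maximal in the dihedral groups <r0, r1> and <r0, r2>,
    of orders 2p and 4, so that no intersection can be too large.  The group P
    cannot be abelian, as two commuting elements of order p generate at most p^2
    elements.

    Second, these data can be scaled down.  If P is a p-group of order at least
    p^m, then P contains a subgroup N, normal in G, with |P : N| = p^m, and G / N
    is the group that is sought.  Normal subgroups of every order exist because
    the abelian group <r0, r2> of exponent 2 acts on the socle of the centre of
    any quotient of P by commuting automorphisms of order at most 2, which
    have a common eigenvector (exists_normal_pgroup_card).

    So it is enough to find some finite group in which the relations hold and P
    is a p-group of order at least p^m.  Such a group acts on Z/p x Z/q with
    q = p^m by
        r0 (i, v) = (- i, v + slope i),   r1 (i, v) = (1 - i, v),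
        r2 (i, v) = (- i, - v),
    where slope is the difference of a function that is symmetric under
    i |-> 1 - i.  Then x is conjugate to the shift of the first coordinate by a
    shear, the elements of P have the form (i, v) |-> (i + c, v + a i), so that
    their orders divide p q, and x y has order at least q since it translates
    the line i = 0 by one. *)

Set Implicit Arguments.
Unset Strict Implicit.
Unset Printing Implicit Defensive.

Local Open Scope group_scope.

(** * Involutions, dihedral groups and the [p, 2p] relations *)

Definition coxeter_relations (gT : finGroupType) (p : nat) (r0 r1 r2 : gT) :=
  [/\ [/\ r0 ^+ 2 = 1, r1 ^+ 2 = 1 & r2 ^+ 2 = 1],
      (r0 * r2) ^+ 2 = 1, (r0 * r1) ^+ p = 1 & (r1 * r2) ^+ (2 * p)%N = 1]%g.

Definition full_group (gT : finGroupType) (r0 r1 r2 : gT) : {group gT} :=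
  [group of <<[set r0; r1; r2]>>].

(** In the Coxeter group [p, 2p] with p odd, this is the kernel of the map onto
    C2 x C2 that sends r0 and r1 to one generator and r2 to the other. *)
Definition index4_group (gT : finGroupType) (r0 r1 r2 : gT) : {group gT} :=
  [group of <<[set r0 * r1; (r0 * r1) ^ r2]>>].

Lemma invol_inv (gT : finGroupType) (r : gT) : r ^+ 2 = 1 -> r^-1 = r.
Proof. by move=> r2; apply/eqP; rewrite eq_invg_mul -expg2 r2. Qed.

Lemma invol_commute (gT : finGroupType) (r s : gT) :
  r ^+ 2 = 1 -> s ^+ 2 = 1 -> (r * s) ^+ 2 = 1 -> commute r s.
Proof.
move=> r2 s2 rs2; rewrite /commute -(invol_inv rs2) invMg.
by rewrite (invol_inv r2) (invol_inv s2).
Qed.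

Lemma card_dihedral_dvd (gT : finGroupType) (r s : gT) (n : nat) :
  r ^+ 2 = 1 -> s ^+ 2 = 1 -> (r * s) ^+ n = 1 ->
  #|<<[set r; s]>>| %| (2 * n)%N.
Proof.
move=> r2 s2 rsn.
have nrs : <[r]> \subset 'N(<[r * s]>).
  rewrite cycle_subG inE -cycleJ cycle_subG.
  have -> : (r * s) ^ r = (r * s)^-1.
    by rewrite /conjg invMg !mulgA mulVg mul1g (invol_inv r2) (invol_inv s2).
  by rewrite groupV cycle_id.
have -> : <<[set r; s]>> = <[r]> <*> <[r * s]>.
  apply/eqP; rewrite eqEsubset gen_subG; apply/andP; split.
  - have rJ : r \in <[r]> <*> <[r * s]>.
      by rewrite (subsetP (joing_subl _ _)) ?cycle_id.
    apply/subsetP=> z /set2P[] -> //; rewrite -(groupMl _ rJ).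
    by rewrite (subsetP (joing_subr _ _)) ?cycle_id.
  - by rewrite join_subG !cycle_subG groupM ?mem_gen ?set21 ?set22.
rewrite norm_joinEl //.
apply: (@dvdn_trans (#|<[r]>| * #|<[r * s]>|)%N).
  by rewrite mul_cardG dvdn_mulr.
by rewrite dvdn_mul // order_dvdn ?r2 ?rsn.
Qed.

(** A subgroup of H containing r has order 2 d with d dividing the prime q.  For
    dihedral H this makes the groups generated by one reflection maximal, which
    is what reduces the intersection property to non-membership of generators. *)
Lemma involution_maximal (gT : finGroupType) (r : gT) (K H : {group gT}) q :
  prime q -> #|H| %| (2 * q)%N -> #[r] = 2 -> r \in K -> K \subset H ->
  K :=: <[r]> \/ K :=: H.
Proof.
move=> q_pr dvH or rK sKH.
have s2K : <[r]> \subset K by rewrite cycle_subG.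
have dK : #|K| %| (2 * q)%N by apply: dvdn_trans dvH; apply: cardSg.
have /dvdnP[d Kd] : 2 %| #|K| by rewrite -or; apply: order_dvdG.
have : d %| q by move: dK; rewrite Kd mulnC dvdn_pmul2l.
case/primeP: (q_pr) => _ /[apply] /orP[/eqP d1|/eqP dq].
  by left; apply/esym/eqP; rewrite eqEcard s2K Kd d1 mul1n -or /order leqnn.
right; apply/eqP; rewrite eqEcard sKH dvdn_leq //.
by rewrite Kd dq mulnC.
Qed.

(** Conjugation by r0 inverts r0 r1 and (r0 r1)^r2, conjugation by r2 exchanges
    them, and r1 = r0 (r0 r1). *)
Lemma index4_group_normal (gT : finGroupType) p (r0 r1 r2 : gT) :
  coxeter_relations p r0 r1 r2 ->
  index4_group r0 r1 r2 <| full_group r0 r1 r2 /\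
  full_group r0 r1 r2 :=: index4_group r0 r1 r2 * <<[set r0; r2]>>.
Proof.
case=> -[r02 r12 r22] c02 _ _.
have cr := invol_commute r02 r22 c02.
set P := index4_group r0 r1 r2; set G := full_group r0 r1 r2.
have xP : r0 * r1 \in P by rewrite mem_gen ?set21.
have yP : (r0 * r1) ^ r2 \in P by rewrite mem_gen ?set22.
have r0G : r0 \in G by rewrite mem_gen // !inE eqxx.
have r1G : r1 \in G by rewrite mem_gen // !inE eqxx orbT.
have r2G : r2 \in G by rewrite mem_gen // !inE eqxx orbT.
have x0 : (r0 * r1) ^ r0 = (r0 * r1)^-1.
  by rewrite /conjg invMg !mulgA mulVg mul1g (invol_inv r02) (invol_inv r12).
have n0 : r0 \in 'N(P).
  rewrite inE -genJ gen_subG; apply/subsetP=> _ /imsetP[z /set2P[]-> ->].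
    by rewrite x0 groupV.
  by rewrite -conjgM -cr conjgM x0 conjVg groupV.
have n2 : r2 \in 'N(P).
  rewrite inE -genJ gen_subG; apply/subsetP=> _ /imsetP[z /set2P[]-> ->] //.
  by rewrite -conjgM -expg2 r22 conjg1.
have sPG : P \subset G.
  by rewrite gen_subG; apply/subsetP=> z /set2P[]->; rewrite ?groupJ ?groupM.
have nK : <<[set r0; r2]>> \subset 'N(P).
  by rewrite gen_subG; apply/subsetP=> z /set2P[]->.
have GE : G :=: P * <<[set r0; r2]>>.
  rewrite -norm_joinEr //; apply/eqP; rewrite eqEsubset gen_subG.
  apply/andP; split; last first.
    by rewrite join_subG sPG gen_subG; apply/subsetP=> z /set2P[]->.
  have k0 : r0 \in P <*> <<[set r0; r2]>>.
    by rewrite (subsetP (joing_subr _ _)) // mem_gen ?set21.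
  apply/subsetP=> z; rewrite !inE -orbA => /or3P[] /eqP-> //.
    rewrite -(mulKg r0 r1) groupM ?groupV //.
    by rewrite (subsetP (joing_subl _ _)).
  by rewrite (subsetP (joing_subr _ _)) // mem_gen ?set22.
split=> //; rewrite /normal sPG GE mul_subG ?normG //.
Qed.

Lemma card_abelian_gen2 (gT : finGroupType) p (x y : gT) :
  (0 < p)%N -> x ^+ p = 1 -> y ^+ p = 1 -> abelian <<[set x; y]>> ->
  #|<<[set x; y]>>| <= (p ^ 2)%N.
Proof.
move=> p0 xp yp; rewrite abelian_gen => ab.
have xy : <[x]> \subset 'C(<[y]>).
  rewrite cycle_subG; apply/centP=> z /cycleP[i ->].
  apply: commuteX; apply: (centsP ab); rewrite ?set21 ?set22 //.
have -> : <<[set x; y]>> = <[x]> <*> <[y]>.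
  by rewrite joing_idl joing_idr.
rewrite cent_joinEl // -(leq_pmul2r (cardG_gt0 (<[x]> :&: <[y]>))) -mul_cardG.
rewrite -[(#|_| * _)%N]muln1 leq_mul ?cardG_gt0 //.
by rewrite leq_mul // dvdn_leq ?order_dvdn ?xp ?yp.
Qed.

(** * The intersection property from pairs of generators *)

(** Every proper standard subgroup turns out to be the intersection of the
    two-generator standard subgroups that contain it; once membership of z in
    the subgroup of I is thus the conjunction, over the generators i outside I,
    of membership in the subgroup that omits i, intersecting subgroups
    amounts to intersecting index sets. *)
Lemma intersection_property_of_pairs (gT : finGroupType) (rho : 'I_3 -> gT) :
  <<[set rho i0; rho i1]>> :&: <<[set rho i1; rho i2]>> \subset <[rho i1]> ->
  <<[set rho i0; rho i1]>> :&: <<[set rho i0; rho i2]>> \subset <[rho i0]> ->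
  <<[set rho i0; rho i2]>> :&: <<[set rho i1; rho i2]>> \subset <[rho i2]> ->
  <[rho i0]> :&: <[rho i1]> \subset [1] ->
  intersection_property rho.
Proof.
set r0 := rho i0; set r1 := rho i1; set r2 := rho i2 => t1 t0 t2 t01.
(* Subsets of 'I_3 are encoded by their three membership bits. *)
pose S a b c := [set g | [|| a && (g == r0), b && (g == r1) | c && (g == r2)]].
have imS (I : {set 'I_3}) : rho @: I = S (i0 \in I) (i1 \in I) (i2 \in I).
  apply/setP=> g; rewrite inE; apply/imsetP/idP => [[[[|[|[|//]]] lti] Ii ->]|].
  - rewrite (_ : Ordinal lti = i0) in Ii *; last exact: val_inj.
    by rewrite Ii eqxx.
  - rewrite (_ : Ordinal lti = i1) in Ii *; last exact: val_inj.
    by rewrite Ii eqxx orbT.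
  - rewrite (_ : Ordinal lti = i2) in Ii *; last exact: val_inj.
    by rewrite Ii eqxx !orbT.
  - by case/or3P=> /andP[Ii /eqP ->]; [exists i0 | exists i1 | exists i2].
have S110 : S true true false = [set r0; r1] by apply/setP=> g; rewrite !inE orbF.
have S101 : S true false true = [set r0; r2] by apply/setP=> g; rewrite !inE.
have S011 : S false true true = [set r1; r2] by apply/setP=> g; rewrite !inE.
have S100 : S true false false = [set r0] by apply/setP=> g; rewrite !inE orbF.
have S010 : S false true false = [set r1] by apply/setP=> g; rewrite !inE orbF.
have S001 : S false false true = [set r2] by apply/setP=> g; rewrite !inE.
have mono z a b c a' b' c' : a ==> a' -> b ==> b' -> c ==> c' ->
    z \in <<S a b c>> -> z \in <<S a' b' c'>>.
  move=> /implyP sa /implyP sb /implyP sc; apply/subsetP/genS/subsetP=> g.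
  rewrite !inE => /or3P[]/andP[h ->]; first by rewrite sa.
    by rewrite sb ?orbT.
  by rewrite sc ?orbT.
have coatoms z a b c : z \in <<S true true true>> ->
    (z \in <<S a b c>>) =
    [&& a || (z \in <<S false true true>>), b || (z \in <<S true false true>>)
      & c || (z \in <<S true true false>>)].
  move=> Gz; apply/idP/and3P => [|[]].
    by case: a; case: b; case: c => //= h; split=> //; apply: mono h.
  case: a; case: b; case: c => //=;
    rewrite ?S110 ?S101 ?S011 ?S100 ?S010 ?S001 ?S000.
  - by move=> _ za zb; rewrite (subsetP t0) // inE zb.
  - by move=> za _ zb; rewrite (subsetP t1) // inE zb.
  - by move=> za zb _; rewrite (subsetP t2) // inE zb.
  move=> za zb zc; rewrite gen0 (subsetP t01) // inE.
  by rewrite (subsetP t0) ?(subsetP t1) // inE zc.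
move=> I J; apply/setP=> z; rewrite !imS !inE.
have [Gz|/negP nGz] := boolP (z \in <<S true true true>>).
  rewrite (coatoms z (i0 \in I)) // (coatoms z (i0 \in J)) //.
  rewrite (coatoms z ((i0 \in I) && _)) //.
  by rewrite !orb_andl andbACA; congr (_ && _); rewrite andbACA.
have out a b c : (z \in <<S a b c>>) = false.
  by apply/negP=> h; apply: nGz; apply: mono h; rewrite implybT.
by rewrite !out.
Qed.

(** * Recognition of string C-groups by their order *)

Definition triple (gT : finGroupType) (r0 r1 r2 : gT) (i : 'I_3) : gT :=
  nth 1 [:: r0; r1; r2] i.

Section Recognition.

Context (gT : finGroupType) (p m : nat) (r0 r1 r2 : gT).
Hypotheses (p_prime : prime p) (p_odd : odd p) (m_ge3 : (3 <= m)%N).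
Hypothesis rels : coxeter_relations p r0 r1 r2.
Let P := index4_group r0 r1 r2.
Let G := full_group r0 r1 r2.
Hypothesis cardP : #|P| = (p ^ m)%N.
Hypothesis cardG : #|G| = (4 * p ^ m)%N.

Let p_gt2 : (2 < p)%N.
Proof. exact: odd_prime_gt2. Qed.

Let pm_gtp2 : (p ^ 2 < p ^ m)%N.
Proof. by rewrite ltn_exp2l // ltnW. Qed.

Let r02 : r0 ^+ 2 = 1. Proof. by case: rels => -[]. Qed.
Let r12 : r1 ^+ 2 = 1. Proof. by case: rels => -[]. Qed.
Let r22 : r2 ^+ 2 = 1. Proof. by case: rels => -[]. Qed.
Let r02_2 : (r0 * r2) ^+ 2 = 1. Proof. by case: rels. Qed.
Let xp : (r0 * r1) ^+ p = 1. Proof. by case: rels. Qed.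
Let zp : (r1 * r2) ^+ (2 * p)%N = 1. Proof. by case: rels. Qed.

(** |G| = 4 p^m exceeds 4 p, which bounds the order of a dihedral subgroup
    generated by two of the three involutions. *)
Lemma dihedral_proper r s n : r ^+ 2 = 1 -> s ^+ 2 = 1 -> (r * s) ^+ n = 1 ->
  (0 < n <= 2 * p)%N -> ~ G \subset <<[set r; s]>>.
Proof.
move=> r_2 s_2 rsn /andP[n0 n2p] /subset_leq_card; rewrite cardG.
have /dvdn_leq := card_dihedral_dvd r_2 s_2 rsn; rewrite muln_gt0 n0 => /(_ isT).
move=> h1 h2; have := leq_trans h2 h1.
have p_p2 : (p <= p ^ 2)%N by rewrite -mulnn leq_pmulr // prime_gt0.
move: pm_gtp2; lia.
Qed.

Lemma gens_sub (H : {group gT}) : r0 \in H -> r1 \in H -> r2 \in H -> G \subset H.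
Proof.
move=> *; rewrite gen_subG; apply/subsetP=> z.
by rewrite !inE -orbA => /or3P[]/eqP->.
Qed.

Let p_gt0 : (0 < p)%N. Proof. exact: prime_gt0. Qed.
Let p2_bound : (0 < p <= 2 * p)%N. Proof. lia. Qed.
Let two_bound : (0 < 2 <= 2 * p)%N. Proof. lia. Qed.
Let full_bound : (0 < 2 * p <= 2 * p)%N. Proof. lia. Qed.

Lemma r2_notin01 : r2 \notin <<[set r0; r1]>>.
Proof.
apply/negP=> h; apply: (dihedral_proper r02 r12 xp p2_bound).
by apply: gens_sub => //; rewrite mem_gen ?set21 ?set22.
Qed.

Lemma r1_notin02 : r1 \notin <<[set r0; r2]>>.
Proof.
apply/negP=> h; apply: (dihedral_proper r02 r22 r02_2 two_bound).
by apply: gens_sub => //; rewrite mem_gen ?set21 ?set22.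
Qed.

Lemma r0_notin12 : r0 \notin <<[set r1; r2]>>.
Proof.
apply/negP=> h; apply: (dihedral_proper r12 r22 zp full_bound).
by apply: gens_sub => //; rewrite mem_gen ?set21 ?set22.
Qed.

Lemma order_generators : [/\ #[r0] = 2, #[r1] = 2 & #[r2] = 2].
Proof.
split; apply: nt_prime_order => //; apply/eqP=> r1E.
- by case/negP: r0_notin12; rewrite r1E group1.
- by case/negP: r1_notin02; rewrite r1E group1.
- by case/negP: r2_notin01; rewrite r1E group1.
Qed.

Lemma order_r01 : #[r0 * r1] = p.
Proof.
apply: nt_prime_order => //; apply/eqP => r01.
case/negP: r0_notin12; suff ->: r0 = r1 by rewrite mem_gen ?set21.
by rewrite -(mulgK r1 r0) r01 mul1g (invol_inv r12).
Qed.

(** Commuting x and y of order p would give |P| <= p^2 < p^m. *)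
Lemma index4_group_nonabelian : ~~ abelian P.
Proof.
apply/negP => /(card_abelian_gen2 p_gt0 xp); rewrite -conjXg xp conj1g => /(_ erefl).
by rewrite leqNgt cardP pm_gtp2.
Qed.

Lemma sqr_r12 : (r1 * r2) ^+ 2 = (r0 * r1)^-1 * (r0 * r1) ^ r2.
Proof.
have c02 := invol_commute r02 r22 r02_2.
rewrite conjMg -(_ : r0 = r0 ^ r2); last by apply/esym/conjg_fixP/commgP.
by rewrite expg2 /conjg invMg (invol_inv r12) (invol_inv r22) !mulgA mulgKV.
Qed.

(** The order n of r1 r2 divides 2 p.  If p did not divide n then (r1 r2)^2 = 1,
    that is y = x, and P would be cyclic.  If n = p, then r1 r2 would be a power
    of its square and so lie in P together with r0 r1; hence r0 r2, an element of
    order at most 2 in a group of odd order, would be trivial. *)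
Lemma order_r12 : #[r1 * r2] = (2 * p)%N.
Proof.
have xP : r0 * r1 \in P by rewrite mem_gen ?set21.
have yP : (r0 * r1) ^ r2 \in P by rewrite mem_gen ?set22.
have dvn : #[r1 * r2] %| (2 * p)%N by rewrite order_dvdn zp.
have pn : p %| #[r1 * r2].
  apply: contraR index4_group_nonabelian => npn.
  have : #[r1 * r2] %| 2.
    by rewrite -(@Gauss_dvdl _ 2 p) // coprime_sym prime_coprime.
  rewrite order_dvdn sqr_r12 -eq_mulVg1 => /eqP yx.
  by rewrite abelian_gen -yx setUid -abelian_gen cycle_abelian.
case/dvdnP: pn => d nE; move: dvn; rewrite nE dvdn_pmul2r // => d2.
have /orP[/eqP d1|/eqP -> //] : (d == 1)%N || (d == 2)%N.
  by case/primeP: (isT : prime 2) => _; apply.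
have zP : r1 * r2 \in P.
  have -> : r1 * r2 = ((r1 * r2) ^+ 2) ^+ (uphalf p).
    rewrite -expgM; have -> : (2 * uphalf p = p.+1)%N.
      rewrite mul2n uphalf_half p_odd doubleD.
      by move: (odd_double_half p); rewrite p_odd; lia.
    have op : #[r1 * r2] = p by rewrite nE d1 mul1n.
    by rewrite expgS -[X in _ ^+ X]op expg_order mulg1.
  by rewrite groupX // sqr_r12 groupM ?groupV.
have r02P : r0 * r2 \in P.
  by rewrite -[r0](mulgK r1) -(mulgA _ _ r2) (invol_inv r12) groupM.
have := order_dvdG r02P; rewrite cardP.
have co : coprime #[r0 * r2] (p ^ m).
  apply: (@coprime_dvdl _ 2); first by rewrite order_dvdn r02_2.
  by rewrite coprime2n oddX p_odd orbT.
move/gcdn_idPl=> nE'; move: co; rewrite /coprime nE' order_eq1 => /eqP r02E.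
case/negP: r2_notin01; suff <- : r0 = r2 by rewrite mem_gen ?set21.
by rewrite -(mulgK r2 r0) r02E mul1g (invol_inv r22).
Qed.

Lemma sylow_nonabelian (Q : {group gT}) : Q \in 'Syl_p(G) -> ~~ abelian Q.
Proof.
have sPG : P \subset G by have [/normal_sub] := index4_group_normal rels.
have sylP : p.-Sylow(G) P.
  have p4 : p^'.-nat (2 ^ 2)%N by rewrite pnatX pnatE // !inE; apply/orP; left; lia.
  have pp : p.-nat (p ^ m)%N by rewrite pnatX pnat_id.
  rewrite pHallE sPG cardP cardG partnM ?expn_gt0 ?p_gt0 //.
  by rewrite (part_p'nat p4) mul1n part_pnat_id /=.
rewrite inE => sylQ; have [g _ ->] := Sylow_trans sylP sylQ.
by rewrite abelianJ index4_group_nonabelian.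
Qed.

Lemma card_r01 : #|<<[set r0; r1]>>| %| (2 * p)%N.
Proof. exact: card_dihedral_dvd. Qed.

(** The intersection of two of the two-generator subgroups lies between a group
    of order 2 and <r0, r1> or <r0, r2>, whose order divides 2 p or 2 * 2, so it
    is one of the two; the larger one would put all three generators in a
    dihedral group. *)
Lemma recognition_intersection : intersection_property (triple r0 r1 r2).
Proof.
have [o0 o1 o2] := order_generators.
have c01 := card_r01.
have c02 := card_dihedral_dvd r02 r22 r02_2.
have mem l (A : {set gT}) : l \in A -> l \in <<A>> by apply: mem_gen.
apply: intersection_property_of_pairs; rewrite /triple /=.
- have [|->//|/setIidPl/subsetP s] :=
      @involution_maximal _ r1 _ <<[set r0; r1]>> p p_prime c01 o1 _
        (subsetIl _ <<[set r1; r2]>>).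
    by rewrite inE !mem ?set21 ?set22.
  by case/negP: r0_notin12; apply: s; rewrite mem ?set21.
- rewrite setIC.
  have [|->//|/setIidPl/subsetP s] :=
      @involution_maximal _ r0 _ <<[set r0; r2]>> 2 isT c02 o0 _
        (subsetIl _ <<[set r0; r1]>>).
    by rewrite inE !mem ?set21 ?set22.
  by case/negP: r2_notin01; apply: s; rewrite mem ?set22.
- have [|->//|/setIidPl/subsetP s] :=
      @involution_maximal _ r2 _ <<[set r0; r2]>> 2 isT c02 o2 _
        (subsetIl _ <<[set r1; r2]>>).
    by rewrite inE !mem ?set21 ?set22.
  by case/negP: r0_notin12; apply: s; rewrite mem ?set21.
rewrite setIC prime_TIg // -?[#|_|]/#[_] ?o1 // cycle_subG.
apply/negP=> h; case/negP: r1_notin02.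
by move: h; apply/subsetP; rewrite cycle_subG mem ?set21.
Qed.

Theorem recognition :
  [/\ string_C_group3 G (triple r0 r1 r2),
      #|G| = (4 * p ^ m)%N,
      schlafli_type (triple r0 r1 r2) = (p, (2 * p)%N)
    & forall Q : {group gT}, Q \in 'Syl_p(G)%g -> ~~ abelian Q].
Proof.
have [o0 o1 o2] := order_generators.
split; [split | exact: cardG | | exact: sylow_nonabelian].
- have ne01 : r0 != r1.
    by apply: contraNneq r0_notin12 => ->; rewrite mem_gen ?set21.
  have ne02 : r0 != r2.
    by apply: contraNneq r0_notin12 => ->; rewrite mem_gen ?set22.
  have ne12 : r1 != r2.
    by apply: contraNneq r1_notin02 => ->; rewrite mem_gen ?set22.
  split; last by case=> [[|[|[|//]]] lti].
  have u : uniq [:: r0; r1; r2] by rewrite /= !inE negb_or ne01 ne02 ne12.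
  by move=> i j /eqP; rewrite nth_uniq // => /eqP/val_inj.
- congr <<_>>; apply/setP=> g; rewrite !inE -orbA; apply/or3P/imsetP.
    by case=> /eqP->; [exists i0 | exists i1 | exists i2]; rewrite ?inE.
  case=> [[[|[|[|//]]] lti] _ ->]; rewrite /triple /= eqxx.
  + by constructor 1.
  + by constructor 2.
  + by constructor 3.
- exact: invol_commute.
- exact: recognition_intersection.
by rewrite /schlafli_type /triple /= order_r01 order_r12.
Qed.

End Recognition.

(** * Normal subgroups of every order below a normal p-group *)

(** Among the central elements w of order p in P, take one whose line <w> has
    the largest stabiliser in K.  If r in K does not stabilise <w>, then
    w w^r is nontrivial (otherwise w^r = w^-1), is fixed by r because r^2 = 1, and spans a line that is
    stabilised by everything that stabilises <w> because K is abelian,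
    contradicting the choice of w. *)
Lemma exists_normal_prime_order (gT : finGroupType) p (P K : {group gT}) :
  prime p -> p.-group P -> P :!=: 1 -> K \subset 'N(P) -> abelian K ->
  (forall k, k \in K -> k ^+ 2 = 1) ->
  exists N : {group gT}, [/\ N \subset P, P <*> K \subset 'N(N) & #|N| = p].
Proof.
move=> p_pr pP ntP nPK abK K2.
have nZK : K \subset 'N('Z(P)) := char_norm_trans (center_char P) nPK.
have [w0 Zw0 ow0] : exists2 w, w \in 'Z(P) & #[w] = p.
  have ntZ : 'Z(P) != 1 by apply: contraNneq ntP => /(trivg_center_pgroup pP)->.
  have [_ pZ _] := pgroup_pdiv (pgroupS (center_sub P) pP) ntZ.
  by have [w] := Cauchy p_pr pZ; exists w.
pose good w := (w \in 'Z(P)) && (#[w] == p).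
have good0 : good w0 by rewrite /good Zw0 ow0 eqxx.
case: (arg_maxnP (fun w => #|'N_K(<[w]>)|) good0) => w /andP[Zw /eqP ow] maxw.
have nwK : K \subset 'N(<[w]>).
  apply: contraT => /subsetPn[r Kr nr].
  pose v := w * w ^ r.
  have Zwr : w ^ r \in 'Z(P) by rewrite memJ_norm ?(subsetP nZK).
  have cww : commute w (w ^ r) := centsP (center_abelian P) _ Zw _ Zwr.
  have ntv : v != 1.
    apply: contraNneq nr => v1.
    have -> : r \in 'N(<[w]>) = (w ^ r \in <[w]>).
      by rewrite inE -cycleJ cycle_subG.
    by rewrite -(mulKg w (w ^ r)) -/v v1 mulg1 groupV cycle_id.
  have gv : good v.
    rewrite /good groupM //=; apply/eqP/nt_prime_order => //.
    by rewrite expgMn // -conjXg -ow expg_order conj1g mulg1.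
  have vr : v ^ r = v by rewrite conjMg -conjgM -expg2 K2 // conjg1 -cww.
  (* v contradicts the choice of w, as r stabilises <v> but not <w>. *)
  have /negP[] : ~~ (#|'N_K(<[v]>)| <= #|'N_K(<[w]>)|)%N; last exact: maxw.
  rewrite -ltnNge proper_card // properE; apply/andP; split; last first.
    apply/subsetPn; exists r; rewrite !inE -!cycleJ ?Kr ?vr //=.
    by apply: contra nr => ?; rewrite inE -cycleJ.
  rewrite subsetI subsetIl /=; apply/subsetP=> k /setIP[Kk].
  rewrite !inE -!cycleJ !cycle_subG => /cycleP[i wk]; apply/cycleP; exists i.
  rewrite expgMn // conjMg -conjgM (centsP abK _ Kr _ Kk) conjgM wk.
  by rewrite conjXg.
exists <[w]>%G; split=> //; first by rewrite cycle_subG (subsetP (center_sub P)).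
rewrite join_subG nwK andbT cents_norm // centsC cycle_subG.
by case/centerP: Zw => _ cw; apply/centP=> z /cw.
Qed.

(** Pull back a normal subgroup of order p of the quotient by a normal subgroup
    of order p^j. *)
Lemma exists_normal_pgroup_card (gT : finGroupType) p (P K : {group gT}) j :
  prime p -> p.-group P -> K \subset 'N(P) -> abelian K ->
  (forall k, k \in K -> k ^+ 2 = 1) -> (p ^ j <= #|P|)%N ->
  exists N : {group gT},
    [/\ N \subset P, P <*> K \subset 'N(N) & #|N| = (p ^ j)%N].
Proof.
move=> p_pr pP nPK abK K2; elim: j => [_|j IHj lej].
  by exists 1%G; rewrite sub1G cards1 norms1.
have lt_j : (p ^ j < p ^ j.+1)%N by rewrite ltn_exp2l ?prime_gt1.
have [N [sNP nN cN]] := IHj (ltnW (leq_trans lt_j lej)).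
have [nNP nNK] : P \subset 'N(N) /\ K \subset 'N(N).
  by apply/andP; rewrite -join_subG.
have nsNP : N <| P by rewrite /normal sNP.
have ntQ : P / N != 1.
  rewrite -cardG_gt1 card_quotient // -divgS // cN.
  by rewrite ltn_divRL -?cN ?cardSg // mul1n cN (leq_trans lt_j).
have KN2 kb : kb \in K / N -> kb ^+ 2 = 1.
  by case/morphimP=> k nk Kk ->; rewrite -morphX // K2 // morph1.
have [M [sM nM cM]] := exists_normal_prime_order p_pr (quotient_pgroup N pP) ntQ
  (quotient_norms N nPK) (quotient_abelian N abK) KN2.
exists (coset N @*^-1 M)%G; split.
- by rewrite sub_cosetpre_quo.
- have nsN : N <| P <*> K by rewrite /normal nN (subset_trans sNP) ?joing_subl.
  rewrite -(quotientGK nsN) quotientY //.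
  have : M <| (P / N) <*> (K / N).
    by rewrite /normal nM (subset_trans sM) ?joing_subl.
  by rewrite -cosetpre_normal => /normal_norm.
by rewrite card_cosetpre cN cM expnSr.
Qed.

(** * Passing to a quotient of the right order *)

(** The relations survive in any quotient, so the recognition theorem applies to
    G / N as soon as N has index p^m in P; the order of G is 4 |P| because P has
    odd order and <r0, r2> is a Klein four-group. *)
Lemma quotient_string_C_group (gT : finGroupType) p m (r0 r1 r2 : gT) :
    prime p -> odd p -> (3 <= m)%N -> coxeter_relations p r0 r1 r2 ->
    p.-group (index4_group r0 r1 r2) -> (p ^ m <= #|index4_group r0 r1 r2|)%N ->
    r0 != 1 -> r2 != 1 -> r0 != r2 ->
  exists (qT : finGroupType) (G : {group qT}) (rho : 'I_3 -> qT),
    [/\ string_C_group3 G rho,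
        #|G| = (4 * p ^ m)%N,
        schlafli_type rho = (p, (2 * p)%N)
      & forall Q : {group qT}, Q \in 'Syl_p(G) -> ~~ abelian Q].
Proof.
move=> p_pr p_odd m3 rels; have [nsPG defG] := index4_group_normal rels.
have [[r02 r12 r22] r0r2 r0r1 r1r2] := rels.
set P := index4_group r0 r1 r2 in nsPG defG *.
set G := full_group r0 r1 r2 in nsPG defG *.
move=> pP lemP nt0 nt2 ne02; set K := <<[set r0; r2]>> in defG.
have c02 := invol_commute r02 r22 r0r2.
have ab02 : abelian [set r0; r2].
  by apply/centsP=> _ /set2P[]-> _ /set2P[]->.
have abK : abelian K by rewrite abelian_gen.
have expK k : k \in K -> k ^+ 2 = 1.
  apply/exponentP: k; rewrite abelian_exponent_gen //; apply/exponentP.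
  by move=> _ /set2P[]->.
have cardK : #|K| = 4.
  have dK : #|K| %| (2 * 2)%N by apply: card_dihedral_dvd.
  have : (2 < #|K|)%N.
    have u : uniq [:: 1; r0; r2].
      by rewrite /= !inE !negb_or !(eq_sym 1) nt0 nt2 ne02.
    rewrite -[X in (X <= _)%N](card_uniqP u); apply/subset_leq_card/subsetP=> z.
    by rewrite !inE => /or3P[]/eqP->; rewrite ?group1 // mem_gen ?set21 ?set22.
  have := dvdn_leq (isT : 0 < 2 * 2)%N dK; case: #|K| dK => [|[|[|[|[|?]]]]] //.
have cardG : #|G| = (#|P| * 4)%N.
  rewrite defG coprime_cardMg ?cardK //; apply: pnat_coprime pP _.
  by rewrite (pnatX _ 2 2) pnatE // !inE orbF neq_ltn odd_prime_gt2.
have nPK : K \subset 'N(P).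
  by apply: subset_trans (normal_norm nsPG); rewrite defG mulG_subr.
have defPK : P <*> K = G by rewrite norm_joinEr // defG.
have /p_natP[l cardP] := pP.
have lem : (m <= l)%N by rewrite -(leq_exp2l _ _ (prime_gt1 p_pr)) -cardP.
have [|N [sNP nN cardN]] :=
    @exists_normal_pgroup_card _ p P K (l - m) p_pr pP nPK abK expK.
  by rewrite cardP leq_exp2l ?prime_gt1 ?leq_subr.
rewrite defPK in nN.
have mem_N r : r \in [set r0; r1; r2] -> r \in 'N(N).
  by move=> Gr; apply: (subsetP nN); apply: mem_gen.
have n0 : r0 \in 'N(N) by rewrite mem_N // !inE eqxx.
have n1 : r1 \in 'N(N) by rewrite mem_N // !inE eqxx orbT.
have n2 : r2 \in 'N(N) by rewrite mem_N // !inE eqxx orbT.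
have sPN : P \subset 'N(N) := subset_trans (normal_sub nsPG) nN.
pose c := coset N.
have quoP : P / N = index4_group (c r0) (c r1) (c r2).
  rewrite /= quotient_gen; last first.
    by apply/subsetP=> z /set2P[]->; rewrite ?groupJ ?groupM.
  by rewrite quotientU !quotient_set1 ?groupJ ?groupM // morphJ ?morphM ?groupM.
have quoG : G / N = full_group (c r0) (c r1) (c r2).
  rewrite /= quotient_gen; last by apply/subsetP.
  by rewrite !quotientU !quotient_set1.
have cardQ (H : {group gT}) : H \subset 'N(N) -> N \subset H ->
    (#|H / N| * p ^ (l - m) = #|H|)%N.
  by move=> nH sH; rewrite card_quotient // -cardN mulnC Lagrange.
have p_gt0 k : (0 < p ^ k)%N by rewrite expn_gt0 prime_gt0.
exists (coset_of N), (full_group (c r0) (c r1) (c r2)),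
  (triple (c r0) (c r1) (c r2)).
apply: recognition => //.
- rewrite /coxeter_relations -!morphM // -!morphX ?groupM //.
  by rewrite r02 r12 r22 r0r2 r0r1 r1r2 !morph1.
- apply/eqP; rewrite -quoP -(eqn_pmul2r (p_gt0 (l - m))) cardQ // cardP.
  by rewrite -expnD subnKC.
apply/eqP; rewrite -quoG -(eqn_pmul2r (p_gt0 (l - m))) cardQ //; last first.
  exact: subset_trans sNP (normal_sub nsPG).
by rewrite cardG cardP mulnC -mulnA -expnD subnKC.
Qed.

(** * A large permutation group satisfying the relations *)

Section ConcreteModel.

Local Open Scope ring_scope.
Import GRing.Theory.

Context (p q : nat) (p_gt2 : (2 < p)%N) (q_gt1 : (1 < q)%N).

Let p_gt1 : (1 < p)%N. Proof. exact: ltnW. Qed.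

Lemma natr_Zp_eq0 n k : (1 < n)%N -> ((k%:R : 'Z_n) == 0) = (n %| k)%N.
Proof. by move=> n1; rewrite -val_eqE /= val_Zp_nat. Qed.

Let T := ('Z_p * 'Z_q)%type.

(** The indicator of the orbit {0, 1} of the reflection i |-> 1 - i. *)
Definition hat (i : 'Z_p) : 'Z_q := (i == 0)%:R + (i == 1)%:R.

(** As a difference, slope sums to zero around the cycle Z/p, which makes
    the p-th power of refl0 * refl1 trivial; the symmetry of the function that it is the
    difference of makes it odd, which makes refl0 an involution commuting with
    refl2. *)
Definition slope (i : 'Z_p) : 'Z_q := hat i - hat (i + 1).

Lemma hat_sym i : hat (1 - i) = hat i.
Proof.
have e0 : (1 - i == 0) = (i == 1) by rewrite subr_eq0 eq_sym.
have e1 : (1 - i == 1) = (i == 0) by rewrite -subr_eq0 addrAC subrr sub0r oppr_eq0.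
by rewrite /hat e0 e1 addrC.
Qed.

Lemma slope_odd i : slope (- i) = - slope i.
Proof.
by rewrite /slope -(hat_sym (- i)) opprK ![_ + 1]addrC hat_sym opprB.
Qed.

Definition refl0_fun (u : T) : T := (- u.1, u.2 + slope u.1).
Definition refl1_fun (u : T) : T := (1 - u.1, u.2).
Definition refl2_fun (u : T) : T := (- u.1, - u.2).

Lemma refl0_funK : involutive refl0_fun.
Proof. by case=> i v; rewrite /refl0_fun /= slope_odd opprK addrK. Qed.
Lemma refl1_funK : involutive refl1_fun.
Proof. by case=> i v; rewrite /refl1_fun /= opprB addrC subrK. Qed.
Lemma refl2_funK : involutive refl2_fun.
Proof. by case=> i v; rewrite /refl2_fun /= !opprK. Qed.

Definition refl0 : {perm T} := perm (inv_inj refl0_funK).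
Definition refl1 : {perm T} := perm (inv_inj refl1_funK).
Definition refl2 : {perm T} := perm (inv_inj refl2_funK).

Lemma rot01E (i : 'Z_p) (v : 'Z_q) : (refl0 * refl1)%g (i, v) = (i + 1, v + slope i).
Proof. by rewrite permM !permE /refl0_fun /refl1_fun /= opprK addrC. Qed.

Lemma rot01XE n (i : 'Z_p) (v : 'Z_q) :
  ((refl0 * refl1) ^+ n)%g (i, v) = (i + n%:R, v + hat i - hat (i + n%:R)).
Proof.
elim: n => [|n IHn]; first by rewrite perm1 addr0 addrK.
by rewrite expgSr permM IHn rot01E /slope addrA subrK -addrA -natr1.
Qed.

Lemma rot12XE n (i : 'Z_p) (v : 'Z_q) :
  ((refl1 * refl2) ^+ n)%g (i, v) = (i - n%:R, (-1) ^+ n * v).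
Proof.
elim: n => [|n IHn]; first by rewrite perm1 subr0 mul1r.
rewrite expgSr permM IHn permM !permE /refl1_fun /refl2_fun /=.
by rewrite opprB -addrA -opprD natr1 exprS mulN1r mulNr.
Qed.

Lemma refl_relations : coxeter_relations p refl0 refl1 refl2.
Proof.
have invol f (fK : involutive f) : ((perm (inv_inj fK) : {perm T}) ^+ 2 = 1)%g.
  by apply/permP=> u; rewrite expg2 permM !permE fK.
have p0 : (p%:R = 0 :> 'Z_p) by apply/eqP; rewrite natr_Zp_eq0.
split; first by split; apply: invol.
- apply/permP=> -[i v]; rewrite expg2 !permM !permE /refl0_fun /refl2_fun /=.
  by rewrite !opprK opprD opprK addrK.
- by apply/permP=> -[i v]; rewrite rot01XE p0 addr0 addrK perm1.
apply/permP=> -[i v]; rewrite rot12XE natrM p0 mulr0 subr0.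
by rewrite exprM sqrrN expr1n expr1n mul1r perm1.
Qed.

Let two_neq0 : (1 + 1 : 'Z_p) != 0.
Proof. by rewrite -[1 + 1]/(2%:R) natr_Zp_eq0 // gtnNdvd. Qed.

Lemma hat_values : [/\ hat 0 = 1, hat 1 = 1 & hat (1 + 1) = 0].
Proof.
have n2 : (1 + 1 == 1 :> 'Z_p) = false by rewrite -subr_eq0 addrK oner_eq0.
rewrite /hat !eqxx n2 (negPf two_neq0) eq_sym oner_eq0.
by rewrite !(addr0, add0r).
Qed.

Lemma refl_neq : [/\ refl0 != 1%g, refl2 != 1%g & refl0 != refl2].
Proof.
have [_ b1 b2] := hat_values.
have n2 : - (1 : 'Z_p) != 1 by rewrite -subr_eq0 -opprD oppr_eq0.
split.
- apply/eqP=> /permP/(_ (1, 0)); rewrite permE perm1 => /(congr1 fst)/eqP /=.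
  by rewrite (negPf n2).
- apply/eqP=> /permP/(_ (1, 0)); rewrite permE perm1 => /(congr1 fst)/eqP /=.
  by rewrite (negPf n2).
apply/eqP=> /permP/(_ (1, 0)); rewrite !permE => /(congr1 snd)/eqP /=.
by rewrite /slope b1 b2 subr0 add0r oppr0 oner_eq0.
Qed.

(** The wreath product of the translations of Z/q by the translations of Z/p,
    as a group of permutations.  It contains both generators of the group that has
    to be a p-group, and its exponent is easily bounded. *)
Definition shift_perms : {set {perm T}} :=
  [set w : {perm T} | [exists c : 'Z_p, exists a : {ffun 'Z_p -> 'Z_q},
    forall u : T, w u == (u.1 + c, u.2 + a u.1)]].

Lemma shift_permP (w : {perm T}) :
  reflect (exists (c : 'Z_p) (a : 'Z_p -> 'Z_q),
             forall i v, w (i, v) = (i + c, v + a i))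
          (w \in shift_perms).
Proof.
rewrite inE; apply: (iffP existsP) => -[c].
  by case/existsP=> a /forallP wE; exists c, a => i v; apply/eqP/(wE (i, v)).
case=> a wE; exists c; apply/existsP; exists [ffun i => a i].
by apply/forallP=> -[i v]; rewrite wE ffunE.
Qed.

Lemma shift_perms_group : group_set shift_perms.
Proof.
apply/group_setP; split=> [|w w'].
  by apply/shift_permP; exists 0, (fun=> 0) => i v; rewrite perm1 !addr0.
move=> /shift_permP[c [a wE]] /shift_permP[c' [a' w'E]].
apply/shift_permP; exists (c + c'), (fun i => a i + a' (i + c)) => i v.
by rewrite permM wE w'E !addrA.
Qed.
Canonical shift_group := Group shift_perms_group.

Lemma shift_perm_exponent (w : {perm T}) : w \in shift_perms -> (w ^+ (p * q) = 1)%g.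
Proof.
case/shift_permP=> c [a wE].
have wXE n : exists b : 'Z_p -> 'Z_q,
    forall i v, (w ^+ n)%g (i, v) = (i + c *+ n, v + b i).
  elim: n => [|n [b IHn]]; first by exists (fun=> 0) => i v; rewrite perm1 !addr0.
  exists (fun i => b i + a (i + c *+ n)) => i v.
  by rewrite expgSr permM IHn wE mulrSr !addrA.
have [b wpE] := wXE p.
have char n (z : 'Z_n) : (1 < n)%N -> z *+ n = 0.
  move=> n1; have n0 : n%:R = 0 :> 'Z_n by apply/eqP; rewrite natr_Zp_eq0.
  by rewrite -mulr_natr n0 mulr0.
have wpXE n i v : (w ^+ p ^+ n)%g (i, v) = (i, v + b i *+ n).
  elim: n => [|n IHn]; first by rewrite perm1 addr0.
  by rewrite expgSr permM IHn wpE char // addr0 mulrSr addrA.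
by apply/permP=> -[i v]; rewrite expgM wpXE char // addr0 perm1.
Qed.

Lemma conj_rot01E (i : 'Z_p) (v : 'Z_q) :
  ((refl0 * refl1) ^ refl2)%g (i, v) = (i - 1, v + slope i).
Proof.
have [[_ _ r22] _ _ _] := refl_relations.
rewrite conjgE (invol_inv r22) !permM !permE /refl0_fun /refl1_fun /refl2_fun /=.
by rewrite slope_odd -opprD !opprK opprB.
Qed.

Lemma index4_group_sub_shift : index4_group refl0 refl1 refl2 \subset shift_group.
Proof.
rewrite gen_subG; apply/subsetP=> w /set2P[]->; apply/shift_permP.
  by exists 1, slope => i v; rewrite rot01E.
by exists (-1), slope => i v; rewrite conj_rot01E.
Qed.

Lemma pgroup_index4_group r : prime r -> r.-nat p -> r.-nat q ->
  (r.-group (index4_group refl0 refl1 refl2))%g.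
Proof.
move=> r_pr rp rq; rewrite -pnat_exponent; apply: (@pnat_dvd _ (p * q)).
  apply/exponentP=> w Pw; apply: shift_perm_exponent.
  exact: (subsetP index4_group_sub_shift).
by rewrite pnatM rp rq.
Qed.

(** x y maps (0, v) to (0, v + 1), so its order is a multiple of q. *)
Lemma card_index4_group_ge : (q <= #|index4_group refl0 refl1 refl2|)%N.
Proof.
pose t := ((refl0 * refl1) * (refl0 * refl1) ^ refl2)%g.
have tP : t \in index4_group refl0 refl1 refl2.
  by rewrite groupM ?mem_gen ?set21 ?set22.
apply: leq_trans (dvdn_leq (cardG_gt0 _) (order_dvdG tP)).
apply: dvdn_leq (order_gt0 _) _.
have [b0 b1 b2] := hat_values.
have tE v : t (0, v) = (0, v + 1).
  rewrite permM rot01E conj_rot01E addrK /slope add0r b0 b1 b2.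
  by rewrite subrr addr0 subr0.
have tXE n v : (t ^+ n)%g (0, v) = (0, v + n%:R).
  elim: n => [|n IHn]; first by rewrite perm1 addr0.
  by rewrite expgSr permM IHn tE -addrA natr1.
rewrite -natr_Zp_eq0 //; have := tXE #[t]%g 0; rewrite expg_order perm1 add0r.
by move=> /(congr1 snd) /= <-.
Qed.

End ConcreteModel.

Local Close Scope group_scope.

Theorem theorem1p3 (p : nat) (p_prime : prime p) (p_odd : odd p)
    (m : nat) (m_ge3 : 3 <= m) :
  exists (gT : finGroupType) (G : {group gT}) (rho : 'I_3 -> gT),
    [/\ string_C_group3 G rho,
        #|G| = 4 * p ^ m,
        schlafli_type rho = (p, 2 * p)
      & forall P : {group gT}, P \in 'Syl_p(G)%g -> ~~ abelian P].
Proof.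
have p_gt2 := odd_prime_gt2 p_odd p_prime.
have q_gt1 : 1 < p ^ m.
  by rewrite -(expn0 p) ltn_exp2l ?prime_gt1 // (leq_trans _ m_ge3).
have [n0 n2 n02] := refl_neq (p ^ m) p_gt2.
apply: (quotient_string_C_group p_prime p_odd m_ge3 (refl_relations _ p_gt2)
          _ (card_index4_group_ge p_gt2 q_gt1) n0 n2 n02).
by apply: pgroup_index4_group; rewrite // ?pnatX pnat_id.
Qed.
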